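(* Let $G$ be a finite simple graph with $d$ vertices, with chromatic polynomial $\chi_G(n)$, and let $h_G(z)$ be defined by $$\sum_{n=0}^{\infty} \chi_G(n) z^n = \frac{h_G(z)}{(1-z)^{d+1}}.$$ Then $h_G(z)$ is a polynomial of degree $d$ with nonnegative coefficients. Also, if $h_G(z) = \sum_{i=0}^{d} h_i z^i$, then for every integer $i$ with $1 \le i \le \left\lfloor \frac{d+1}{2} \right\rfloor$, $$h_{d} + h_{d-1} + \cdots + h_{d-i+1} - h_0 - h_1 - \cdots - h_{i-1} \ge 0.$$
   Context: The chromatic polynomial $\chi_G(n)$ counts the maps $\phi: V \to \{1, \ldots, n\}$ on the vertex set $V$ of $G$ such that $\phi(v) \ne \phi(w)$ whenever $vw$ is an edge of $G$. *)

(* Defs.v *)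
From HB Require Import structures.
From mathcomp Require Import all_boot all_order all_algebra.

Set Implicit Arguments.
Unset Strict Implicit.
Unset Printing Implicit Defensive.

Import GRing.Theory Num.Theory.
Local Open Scope ring_scope.

Definition proper_coloring (T : finType) (e : rel T) (n : nat)
    (phi : {ffun T -> 'I_n}) : bool :=
  [forall v, forall w, e v w ==> (phi v != phi w)].

(* The colors {1, ..., n} are encoded by 'I_n = {0, ..., n - 1}. *)
Definition chromatic (T : finType) (e : rel T) (n : nat) : nat :=
  #|[set phi : {ffun T -> 'I_n} | proper_coloring e phi]|.

(* A formal power series over R is represented by its sequence of
   coefficients nat -> R; this is the Cauchy product. *)
Definition pseries_mul (R : pzSemiRingType) (a b : nat -> R) (n : nat) : R :=
  \sum_(i < n.+1) a i * b (n - i)%N.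

Definition pseries_of_poly (R : nzSemiRingType) (p : {poly R}) (n : nat) : R :=
  p`_n.

(* The identity sum_n chi_G(n) z^n = h(z) / (1 - z)^(d+1) of formal power
   series, with the denominator cleared: (1 - z)^(d+1) is an invertible
   power series, so exactly one series h satisfies it. *)
Definition chromatic_numerator (T : finType) (e : rel T) (h : nat -> int) :
    Prop :=
  pseries_mul (fun n => (chromatic e n)%:Z)
              (pseries_of_poly ((1 - 'X) ^+ #|T|.+1)) =1 h.

(* Main.v *)
Require Import Defs.
From HB Require Import structures.
From mathcomp Require Import all_boot all_order all_algebra.
From mathcomp Require Import zify ring.

(* Nonnegativity.  Group the proper colorings phi by the acyclic orientation O
   of G that they induce (edges point to the larger color), and label the
   vertices by w, increasing along O.  Sorting the vertices by increasing phi,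
   ties broken by decreasing w, splits the colorings inducing O into classes
   indexed by linear orders of the vertices; a class is cut out by weak
   inequalities between neighbors in the order, strict except at the descents
   of w, so it has C(n + des, d) elements, with generating function
   z^(d - des) / (1 - z)^(d + 1).

   The inequality.  Deletion-contraction of an edge a gives
   h_G = h_(G-a) - (1 - z) h_(G/a), where G/a has d - 1 vertices.  In the
   difference h_d + ... + h_(d-i+1) - h_0 - ... - h_(i-1) the factor 1 - z
   telescopes, so that passing from G - a to G adds the coefficients of z^(i-1)
   and z^(d-i) in h_(G/a), both nonnegative.  The coefficient h_d does not
   decrease either.  This reduces everything to the edgeless graph, where h is
   the Eulerian polynomial: h_j = h_(d+1-j), so the difference is h_i. *)

Set Implicit Arguments.
Unset Strict Implicit.
Unset Printing Implicit Defensive.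

Import Order.TTheory GRing.Theory Num.Theory.

(** * Numerators of generating functions *)

Local Open Scope ring_scope.

(** Truncating [f] beyond degree [n] does not affect coefficient [n], so products of series inherit
    the algebra of polynomials. *)
Lemma pseries_mul_coef (R : nzSemiRingType) (f : nat -> R) (p : {poly R})
    (N n : nat) : (n < N)%N ->
  pseries_mul f (pseries_of_poly p) n = (\poly_(i < N) f i * p)`_n.
Proof.
move=> ltnN; rewrite coefM; apply: eq_bigr => i _.
by rewrite coef_poly (leq_ltn_trans _ ltnN) // -ltnS.
Qed.

Lemma pseries_mulM (R : nzSemiRingType) (f : nat -> R) (p q : {poly R}) :
  pseries_mul f (pseries_of_poly (p * q)) =1
  pseries_mul (pseries_mul f (pseries_of_poly p)) (pseries_of_poly q).
Proof.
move=> n; rewrite (pseries_mul_coef _ _ (ltnSn n)) mulrA coefM.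
by apply: eq_bigr => i _; rewrite -pseries_mul_coef.
Qed.

Lemma pseries_mul_1subX (R : nzRingType) (f : nat -> R) (n : nat) :
  pseries_mul f (pseries_of_poly (1 - 'X)) n =
  f n - (if n is m.+1 then f m else 0).
Proof.
rewrite (pseries_mul_coef _ _ (ltnSn n)) mulrBr mulr1 coefB coefMX coef_poly.
by rewrite ltnSn; case: n => [|n] //=; rewrite coef_poly leqnSn.
Qed.

(* The coefficients of (1 - z)^(d + 1) * sum_n f(n) z^n. *)
Definition hvec (d : nat) (f : nat -> int) : nat -> int :=
  pseries_mul f (pseries_of_poly ((1 - 'X) ^+ d.+1)).

Lemma eq_hvec (d : nat) (f g : nat -> int) : f =1 g -> hvec d f =1 hvec d g.
Proof. by move=> fg n; apply: eq_bigr => i _; rewrite fg. Qed.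

Lemma hvecB (d : nat) (f g : nat -> int) (n : nat) :
  hvec d (fun m => f m - g m) n = hvec d f n - hvec d g n.
Proof. by rewrite /hvec /pseries_mul -sumrB; apply: eq_bigr => i _; rewrite mulrBl. Qed.

Lemma hvec_sum (d N : nat) (c : nat -> int) (f : nat -> nat -> int) (n : nat) :
  hvec d (fun m => \sum_(s < N) c s * f s m) n = \sum_(s < N) c s * hvec d (f s) n.
Proof.
rewrite /hvec /pseries_mul.
under eq_bigr do rewrite mulr_suml.
rewrite exchange_big /=; apply: eq_bigr => s _.
by rewrite mulr_sumr; apply: eq_bigr => i _; rewrite mulrA.
Qed.

(** The extra factor 1 - z brings a graph with one vertex fewer to the common denominator. *)
Lemma hvecS (d : nat) (f : nat -> int) (n : nat) :
  hvec d.+1 f n = hvec d f n - (if n is m.+1 then hvec d f m else 0).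
Proof.
by rewrite /hvec exprSr pseries_mulM pseries_mul_1subX.
Qed.

Lemma hvec_bin (d s : nat) (n : nat) : (s <= d)%N ->
  hvec d (fun m => 'C(m + d - s, d)%:Z) n = (n == s)%:Z.
Proof.
(* The generalization to z^s / (1 - z)^(k + 1) with k < s allowed makes the
   induction on k possible. *)
have hvec_shift k (m : nat) :
  hvec k (fun m => if (m < s)%N then 0 else 'C(m - s + k, k)%:Z) m = (m == s)%:Z.
  elim: k m => [|k IHk] m.
    rewrite /hvec expr1 pseries_mul_1subX.
    case: m => [|m]; first by rewrite subr0 bin0; case: s.
    by rewrite /= !bin0; case: (ltngtP m.+1 s).
  rewrite -IHk /hvec exprS pseries_mulM; apply: eq_bigr => i _; congr (_ * _).
  rewrite pseries_mul_1subX; case: i => -[|i] _ /=.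
    by clear; case: s => [|s] /=; rewrite subr0 ?binn.
  case: (ltngtP i.+1 s) => H.
  - by rewrite subrr.
  - have -> : (i.+1 - s + k.+1 = (i - s + k.+1).+1)%N by lia.
    have -> : (i.+1 - s + k = i - s + k.+1)%N by lia.
    by rewrite binS PoszD addrAC subrr add0r.
  - by rewrite H subnn !add0n !binn subr0.
(* For m < s <= d the upper index m + d - s is below d, so the binomial vanishes just where the
   shifted series is cut off. *)
move=> sd; rewrite -(hvec_shift d); apply: eq_hvec => m /=.
by case: ltnP => H; [rewrite bin_small // |congr ('C(_, _)%:Z)]; lia.
Qed.

(** * Counting lexicographically increasing words *)

Local Open Scope nat_scope.

(* Since C(n + d - s, d) has generating function z^s / (1 - z)^(d + 1) for
   s <= d, this says that the numerator of f has degree at most d and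
   natural coefficients. *)
Definition bin_expansion (d : nat) (f : nat -> nat) : Prop :=
  exists a : nat -> nat,
    forall n, f n = \sum_(s < d.+1) a s * 'C(n + d - s, d).

Lemma bin_expansion0 (d : nat) (f : nat -> nat) :
  (forall n, f n = 0) -> bin_expansion d f.
Proof.
by move=> f0; exists (fun=> 0) => n; rewrite f0 big1.
Qed.

Lemma bin_expansion1 (d s : nat) (f : nat -> nat) : s <= d ->
  (forall n, f n = 'C(n + d - s, d)) -> bin_expansion d f.
Proof.
rewrite -ltnS => sd fE; exists (fun i => i == s) => n.
rewrite (bigD1 (Ordinal sd)) //= eqxx mul1n fE big1 ?addn0 // => i.
by rewrite -val_eqE /= => /negPf ->.
Qed.

Lemma bin_expansion_sum (d : nat) (I : finType) (F : I -> nat -> nat)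
    (f : nat -> nat) :
  (forall i, bin_expansion d (F i)) -> (forall n, f n = \sum_i F i n) ->
  bin_expansion d f.
Proof.
move=> FP fE; have [a aP] := fin_all_exists FP.
exists (fun s => \sum_i a i s) => n; rewrite fE.
under eq_bigr do rewrite aP.
by rewrite exchange_big /=; apply: eq_bigr => s _; rewrite big_distrl.
Qed.

(* The second components are compared in decreasing order: along a relation
   on which w increases, lexlt is then strict on the first components. *)
Definition lexlt (p q : nat * nat) : bool :=
  (p.1 < q.1) || (p.1 == q.1) && (q.2 < p.2).

Lemma lexlt_irr : irreflexive lexlt.
Proof. by move=> p; rewrite /lexlt !ltnn andbF. Qed.

Lemma lexlt_trans : transitive lexlt.
Proof. by move=> [a b] [a' b'] [a'' b'']; rewrite /lexlt /=; lia. Qed.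

Fixpoint ndesc (b0 : nat) (b : seq nat) : nat :=
  if b is b1 :: b' then (b1 < b0) + ndesc b1 b' else 0.

Lemma ndesc_le (b0 : nat) (b : seq nat) : ndesc b0 b <= size b.
Proof.
by elim: b b0 => //= b1 b IHb b0; have := IHb b1; lia.
Qed.

(** Hockey-stick identity; w <= k ensures ['C(w, k.+1)] = 0, the empty sum. *)
Lemma sum_bin_shift (m w k : nat) : w <= k ->
  \sum_(i < m) 'C(i + w, k) = 'C(m + w, k.+1).
Proof.
move=> wk; elim: m => [|m IHm]; first by rewrite big_ord0 bin_small.
by rewrite big_ord_recr /= IHm addSn binS.
Qed.

Lemma card_tuple_cons (T : finType) (k : nat) (P : pred (seq T)) :
  #|[set t : k.+1.-tuple T | P t]| =
  \sum_(c : T) #|[set t : k.-tuple T | P (c :: t)]|.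
Proof.
rewrite -sum1dep_card (partition_big (@thead _ _) predT) //=.
apply: eq_bigr => c _; rewrite -sum1dep_card.
rewrite (reindex (fun t : k.-tuple T => [tuple of c :: t])) /=; last first.
  pose ttail (t : k.+1.-tuple T) := [tuple of behead t].
  exists ttail => [t _ | t /andP[_ /eqP <-]]; first exact: val_inj.
  by rewrite -tuple_eta.
by apply: eq_bigl => t; rewrite theadE eqxx andbT.
Qed.

(** The next letter must exceed [c0], or may equal it at a descent of [b]; each descent thus acts as
    one additional letter of the alphabet. *)
Lemma card_path_lexlt (n c0 b0 k : nat) (b : seq nat) : c0 < n -> size b = k ->
  #|[set t : k.-tuple 'I_n | path lexlt (c0, b0) (zip (map (@nat_of_ord n) t) b)]| =
  'C(n.-1 - c0 + ndesc b0 b, k).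
Proof.
elim: k b b0 c0 => [|k IHk] [|b1 b] //= b0 c0 lt_c0n.
  by move=> _; rewrite bin0 (@eq_card1 _ [tuple]) // => t; rewrite [t]tuple0 inE.
case=> sz_b; have := ndesc_le b1 b; rewrite sz_b => le_k.
rewrite (card_tuple_cons _ (fun s =>
  path lexlt (c0, b0) (zip (map (@nat_of_ord n) s) (b1 :: b)))) /=.
pose W := ndesc b1 b.
(* Reflecting c to n - 1 - c turns the sum over the [m] largest letters into a hockey-stick sum. *)
have count_from m : m <= n ->
  \sum_(c < n | n <= c + m) 'C(n.-1 - c + W, k) = 'C(m + W, k.+1).
  move=> le_mn; rewrite -(sum_bin_shift _ le_k).
  rewrite (reindex_inj rev_ord_inj) /= (big_ord_widen _ (fun i => 'C(i + W, k)) le_mn).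
  by apply: eq_big => [i|i _]; [|congr 'C(_ + _, _)]; have := ltn_ord i; lia.
under eq_bigr => c _.
  rewrite (_ : #|_| = if lexlt (c0, b0) (c : nat, b1) then 'C(n.-1 - c + W, k) else 0).
    over.
  case: ifP => H; last by apply: eq_card0 => t; rewrite inE.
  by rewrite /W -(IHk b b1 c).
rewrite -big_mkcond /=.
transitivity (\sum_(c < n | n <= c + (n.-1 - c0 + (b1 < b0))) 'C(n.-1 - c + W, k)).
  by apply: eq_bigl => c; rewrite /lexlt /=; have := ltn_ord c; lia.
by rewrite count_from ?addnA //; lia.
Qed.

Lemma card_sorted_lexlt (n k b0 : nat) (b : seq nat) : size b = k ->
  #|[set t : k.+1.-tuple 'I_n | sorted lexlt (zip (map (@nat_of_ord n) t) (b0 :: b))]| =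
  'C(n + ndesc b0 b, k.+1).
Proof.
move=> sz_b; have := ndesc_le b0 b; rewrite sz_b => le_k.
rewrite (card_tuple_cons _ (fun s =>
  sorted lexlt (zip (map (@nat_of_ord n) s) (b0 :: b)))) /=.
rewrite -(sum_bin_shift _ le_k) (reindex_inj rev_ord_inj) /=.
apply: eq_bigr => c _; rewrite card_path_lexlt //=; last by have := ltn_ord c; lia.
by congr 'C(_ + _, _); have := ltn_ord c; lia.
Qed.

(** * P-partitions *)

(** Since [l] lists every vertex, reading [phi] along [l] is a bijection from colorings to words. *)
Lemma card_ffun_sorted_lexlt (T : finType) (n : nat) (w : T -> nat)
    (l : #|T|.-tuple T) : (forall x, x \in l) ->
  #|[set phi : {ffun T -> 'I_n} |
      sorted (fun x y => lexlt (phi x : nat, w x) (phi y : nat, w y)) l]| =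
  #|[set t : #|T|.-tuple 'I_n |
      sorted lexlt (zip (map (@nat_of_ord n) t) (map w l))]|.
Proof.
move=> l_full; pose h (phi : {ffun T -> 'I_n}) := map_tuple phi l.
have h_bij : bijective h.
  apply: inj_card_bij => [phi psi /(congr1 val) /eq_in_map eq_phi|].
    by apply/ffunP => x; apply: eq_phi.
  by rewrite card_tuple card_ffun card_ord.
rewrite -(on_card_preimset (onW_bij _ h_bij)).
apply: eq_card => phi; rewrite !inE /= -map_comp.
by rewrite zip_map sorted_map.
Qed.

(* This is Stanley's (P, omega)-partition theorem, where D need not be transitive
   or even acyclic. *)
Lemma omega_partition_expansion (T : finType) (w : T -> nat) (D : rel T) :
  injective w ->
  bin_expansion #|T| (fun n => #|[set phi : {ffun T -> 'I_n} |
    [forall x, forall y, D x y ==> lexlt (phi x : nat, w x) (phi y : nat, w y)]]|).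
Proof.
move=> w_inj.
pose lt n (phi : {ffun T -> 'I_n}) x y := lexlt (phi x : nat, w x) (phi y : nat, w y).
have lt_tr n phi : transitive (@lt n phi) by move=> y x z; apply: lexlt_trans.
have lt_irr n phi : irreflexive (@lt n phi) by move=> x; apply: lexlt_irr.
have lt_total n phi x y : x != y -> @lt n phi x y || lt n phi y x.
  by rewrite -(inj_eq w_inj) /lt /lexlt /=; lia.
(* Injectivity of [w] makes [lt] a strict total order. Hence each [phi] has exactly one increasing
   listing [srt n phi] of the vertices, and these listings index the classes. *)
pose le n phi x y := (x == y) || @lt n phi x y.
pose srt n phi := sort (@le n phi) (enum T).
have srt_lt n phi : sorted (@lt n phi) (srt n phi).
  have le_tr : transitive (le n phi).
    move=> y x z /predU1P[-> //|xy] /predU1P[<-|yz]; first by rewrite /le xy orbT.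
    by rewrite /le (lt_tr _ _ _ _ _ xy yz) orbT.
  have le_total : total (le n phi).
    by move=> x y; rewrite /le; case: eqVneq => //= /lt_total.
  have: uniq (srt n phi) by rewrite sort_uniq enum_uniq.
  have: sorted (le n phi) (srt n phi) by apply: sort_sorted.
  rewrite (sorted_pairwise (lt_tr n phi)) (sorted_pairwise le_tr) uniq_pairwise.
  move=> le_s ne_s; have: pairwise [rel x y | le n phi x y && (x != y)] (srt n phi).
    by rewrite pairwise_relI le_s.
  by apply: sub_pairwise => x y /andP[/predU1P[->|//]]; rewrite eqxx.
have srt_full n phi x : x \in srt n phi by rewrite mem_sort mem_enum.
have size_srt n phi : size (srt n phi) == #|T| by rewrite size_sort -cardE.
have srtP n phi (l : #|T|.-tuple T) : (forall x, x \in l) ->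
    (Tuple (size_srt n phi) == l) = sorted (lt n phi) l.
  move=> l_full; apply/eqP/idP => [<- //|l_lt]; apply: val_inj => /=.
  apply: (irr_sorted_eq (lt_tr n phi) (lt_irr n phi)) => // x.
  by rewrite srt_full l_full.
apply: (@bin_expansion_sum _ _ (fun (l : #|T|.-tuple T) n =>
   #|[set phi : {ffun T -> 'I_n} | [forall x, forall y, D x y ==> lt n phi x y] &&
     (Tuple (size_srt n phi) == l)]|)); last first.
  move=> n; rewrite -sum1dep_card.
  rewrite (partition_big (fun phi => Tuple (size_srt n phi)) predT) //=.
  by apply: eq_bigr => l _; rewrite sum1dep_card.
move=> l; case: (boolP [forall x, x \in l]) => [/forallP l_full|l_part]; last first.
  apply: bin_expansion0 => n; apply: eq_card0 => phi; rewrite inE.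
  apply: contraNF l_part => /andP[_ /eqP <-]; apply/forallP => x.
  exact: srt_full.
(* Within the class of [l], the condition imposed by [D] depends on [l] alone: either all members
   satisfy it or none does. *)
have D_index n phi : sorted (lt n phi) l ->
    [forall x, forall y, D x y ==> lt n phi x y] =
    [forall x, forall y, D x y ==> (index x l < index y l)].
  move=> l_lt; apply: eq_forallb => x; apply: eq_forallb => y; congr (_ ==> _).
  apply/idP/idP => [|ixy]; last exact: (sorted_ltn_index (lt_tr n phi) l_lt).
  move=> xy; rewrite ltnNge leq_eqVlt; apply/negP => /predU1P[|iyx].
    by move/(index_inj x (l_full y) (l_full x)) => eq_xy; move: xy; rewrite eq_xy lt_irr.
  have yx: lt n phi y x by apply: (sorted_ltn_index (lt_tr n phi) l_lt).
  by have := lt_tr _ _ _ _ _ xy yx; rewrite lt_irr.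
case: (boolP [forall x, forall y, D x y ==> (index x l < index y l)]) => [Dl|notDl];
  last first.
  apply: bin_expansion0 => n; apply: eq_card0 => phi; rewrite inE srtP //.
  by apply: contraNF notDl => /andP[phiD l_lt]; rewrite -(D_index n phi).
have FE n : #|[set phi : {ffun T -> 'I_n} |
    [forall x, forall y, D x y ==> lt n phi x y] && (Tuple (size_srt n phi) == l)]| =
  #|[set t : #|T|.-tuple 'I_n |
      sorted lexlt (zip (map (@nat_of_ord n) t) (map w l))]|.
  rewrite -card_ffun_sorted_lexlt //; apply: eq_card => phi; rewrite !inE srtP //.
  by apply/andP/idP => [[] //|l_lt]; rewrite D_index.
move: l FE {l_full D_index srtP Dl} => l FE.
have := size_tuple l; case El: (tval l) FE => [|x0 l'] FE sz_l.
  apply: (@bin_expansion1 _ 0) => // n; rewrite FE -sz_l bin0.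
  by rewrite (@eq_card1 _ [tuple]) // => t; rewrite [t]tuple0 inE.
have le_d : ndesc (w x0) (map w l') <= size l' by rewrite -(size_map w) ndesc_le.
(* The shift is s = d - des, because C(n + des, d) = C(n + d - s, d). *)
apply: (@bin_expansion1 _ (#|T| - ndesc (w x0) (map w l'))).
  exact: leq_subr.
move=> n; rewrite FE -sz_l /= (@card_sorted_lexlt _ (size l')) ?size_map //.
by congr 'C(_, _); rewrite /=; lia.
Qed.

(** * Chromatic polynomials: nonnegativity and deletion-contraction *)

Lemma chromatic_expansion (T : finType) (e : rel T) :
  bin_expansion #|T| (chromatic e).
Proof.
pose adj x y := e x y || e y x.
pose ori n (phi : {ffun T -> 'I_n}) : {set T * T} :=
  [set p | adj p.1 p.2 & phi p.1 < phi p.2].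
apply: (@bin_expansion_sum _ _ (fun (O : {set T * T}) n =>
   #|[set phi : {ffun T -> 'I_n} | proper_coloring e phi && (ori n phi == O)]|));
  last first.
  move=> n; rewrite /chromatic -sum1dep_card (partition_big (ori n) predT) //=.
  by apply: eq_bigr => O _; rewrite sum1dep_card.
move=> O.
have zero : (forall n phi, ~~ (proper_coloring e phi && (ori n phi == O))) ->
  bin_expansion #|T| (fun n =>
   #|[set phi : {ffun T -> 'I_n} | proper_coloring e phi && (ori n phi == O)]|).
  move=> O0; apply: bin_expansion0 => n; apply: eq_card0 => phi.
  by rewrite inE; apply: negPf.
have [O_adj|O_nadj] := boolP [forall p in O, adj p.1 p.2]; last first.
  apply: zero => n phi; apply: contra O_nadj => /andP[_ /eqP <-].
  by apply/forall_inP => p; rewrite inE => /andP[].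
have [O_full|O_part] :=
    boolP [forall x, forall y, e x y ==> (((x, y) \in O) || ((y, x) \in O))]; last first.
  apply: zero => n phi; apply: contra O_part => /andP[/forallP phiP /eqP <-].
  apply/forallP => x; apply/forallP => y; apply/implyP => exy.
  have := forallP (phiP x) y; rewrite exy !inE /adj /= exy orbT /=.
  by rewrite -val_eqE neq_ltn.
have [/existsP[l /andP[/forallP l_full /forall_inP l_O]]|no_l] := boolP
    [exists l : #|T|.-tuple T, [forall x, x \in l] &&
      [forall p in O, index p.1 l < index p.2 l]]; last first.
  apply: zero => n phi; apply: contra no_l => /andP[_ /eqP <-].
  (* Sorting by a coloring that induces [O] would give a linear extension of [O]. *)
  pose le x y := phi x <= phi y.
  have le_tr : transitive le by move=> y x z; apply: leq_trans.
  have le_total : total le by move=> x y; apply: leq_total.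
  have sz : size (sort le (enum T)) == #|T| by rewrite size_sort -cardE.
  have in_s x : x \in sort le (enum T) by rewrite mem_sort mem_enum.
  apply/existsP; exists (Tuple sz); apply/andP; split; first exact/forallP.
  apply/forall_inP => -[x y]; rewrite inE /= => /andP[_ lt_xy].
  rewrite ltnNge; apply: contraL lt_xy; rewrite -leqNgt.
  by apply: (sorted_leq_index le_tr) => //; [move=> z; apply: leqnn|apply: sort_sorted].
(* Labels are positions in the linear extension [l]. They increase along [O], so there [lexlt]
   amounts to strict increase of [phi]. *)
have w_inj : injective (fun x => index x l).
  by move=> x y; apply: (index_inj x).
have [a aP] := omega_partition_expansion (fun x y => (x, y) \in O) w_inj.
exists a => n; rewrite -aP; apply: eq_card => phi; rewrite !inE.
apply/andP/forallP => [[_ /eqP eqO] x|phiO].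
  apply/forallP => y; apply/implyP; rewrite -eqO inE => /andP[_ lt_xy].
  by rewrite /lexlt lt_xy.
have phi_lt x y : (x, y) \in O -> phi x < phi y.
  move=> xyO; have := forallP (phiO x) y; rewrite xyO /=.
  by have := l_O _ xyO; rewrite /lexlt /=; lia.
have fullP x y : e x y -> ((x, y) \in O) || ((y, x) \in O).
  by move=> exy; have := forallP (forallP O_full x) y; rewrite exy.
split.
  apply/forallP => x; apply/forallP => y; apply/implyP => /fullP.
  by rewrite -val_eqE neq_ltn => /orP[] /phi_lt ->; rewrite ?orbT.
(* [O] orients every adjacent pair, so a coloring increasing along [O] induces no other
   orientation. *)
apply/eqP/setP => -[x y]; rewrite inE /=; apply/andP/idP => [[adj_xy lt_xy]|xyO].
  have : ((x, y) \in O) || ((y, x) \in O).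
    by case/orP: adj_xy => /fullP //; rewrite orbC.
  case/orP => // /phi_lt lt_yx; by have := ltn_trans lt_xy lt_yx; rewrite ltnn.
by split; [apply: (forall_inP O_adj _ xyO)|apply: phi_lt].
Qed.

Local Open Scope ring_scope.

Lemma hvec_expansion (d : nat) (f a : nat -> nat) :
  (forall n, f n = \sum_(s < d.+1) a s * 'C(n + d - s, d))%N ->
  forall n, hvec d (fun m => (f m)%:Z) n = if (n <= d)%N then (a n)%:Z else 0.
Proof.
move=> fE n; rewrite (@eq_hvec _ _ (fun m => \sum_(s < d.+1)
    (a s)%:Z * 'C(m + d - s, d)%:Z)); last first.
  move=> m; rewrite fE (big_morph Posz PoszD (erefl _)).
  by apply: eq_bigr => s _; rewrite PoszM.
rewrite (hvec_sum _ _ (fun s => (a s)%:Z) (fun s m => 'C(m + d - s, d)%:Z)).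
under eq_bigr => s _ do rewrite hvec_bin -1?ltnS //.
case: leqP => [|lt_dn]; last first.
  by apply: big1 => s _; rewrite gtn_eqF ?mulr0 // (leq_trans (ltn_ord s)).
rewrite -ltnS => lt_nd; rewrite (bigD1 (Ordinal lt_nd)) //= eqxx mulr1.
rewrite big1 ?addr0 // => s; rewrite -val_eqE /= eq_sym => /negPf ->.
by rewrite mulr0.
Qed.

Definition chromatic_hvec (T : finType) (e : rel T) : nat -> int :=
  hvec #|T| (fun n => (chromatic e n)%:Z).

Lemma chromatic_hvec_ge0 (T : finType) (e : rel T) (i : nat) :
  0 <= chromatic_hvec e i.
Proof.
have [a aP] := chromatic_expansion e.
by rewrite /chromatic_hvec (hvec_expansion aP); case: ifP.
Qed.

Lemma chromatic_hvec_eq0 (T : finType) (e : rel T) (i : nat) :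
  (#|T| < i)%N -> chromatic_hvec e i = 0.
Proof.
have [a aP] := chromatic_expansion e.
by rewrite /chromatic_hvec (hvec_expansion aP) => /ltn_geF ->.
Qed.

Definition delete_edge (T : finType) (e : rel T) (x y : T) : rel T :=
  [rel u v | e u v && ((u, v) \notin [:: (x, y); (y, x)])].

(* The contraction of xy lives on the vertices other than y; merge sends y to x. *)
Definition merge (T : finType) (x y : T) (neq_xy : x != y) (u : T) :
    {v : T | v != y} :=
  insubd (exist _ x neq_xy) u.

Lemma val_merge (T : finType) (x y : T) (neq_xy : x != y) (u : T) :
  val (merge neq_xy u) = if u == y then x else u.
Proof.
rewrite /merge; have := val_insubd (exist (fun v => v != y) x neq_xy) u.
by case: (u == y).
Qed.

Definition contract_edge (T : finType) (e : rel T) (x y : T) (neq_xy : x != y) :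
    rel {v : T | v != y} :=
  [rel u v | [exists u', exists v',
     [&& merge neq_xy u' == u, merge neq_xy v' == v & e u' v']]].

Lemma card_contracted (T : finType) (y : T) : #|{: {v : T | v != y}}|.+1 = #|T|.
Proof.
rewrite card_sig -[RHS]prednK; last by apply/card_gt0P; exists y.
by rewrite -(cardC1 y).
Qed.

(** Colorings of the deletion with different colors at x and y are those of the graph; those with
    equal colors factor through [merge]. *)
Lemma deletion_contraction (T : finType) (e : rel T) (x y : T)
    (neq_xy : x != y) (n : nat) : e x y ->
  chromatic (delete_edge e x y) n =
  (chromatic e n + chromatic (contract_edge (delete_edge e x y) neq_xy) n)%N.
Proof.
move=> exy; pose m := merge neq_xy.
have mE u : u != y -> val (m u) = u by rewrite val_merge => /negPf ->.
have my : m y = m x.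
  by apply: val_inj; rewrite !val_merge eqxx (negPf neq_xy).
rewrite /chromatic -(cardsID [set phi : {ffun T -> 'I_n} | phi x != phi y]).
congr (_ + _)%N.
  apply: eq_card => phi; rewrite !inE; apply/andP/idP.
    case=> /forallP phiP neq_phi; apply/forallP => u; apply/forallP => v.
    apply/implyP => euv; have := forallP (phiP u) v; rewrite /delete_edge /= euv /= !inE.
    by case: eqP => [[-> ->] _|_] //=; case: eqP => [[-> ->] _|_] //=; rewrite eq_sym.
  move=> /forallP phiP; have phi_ne u v : e u v -> phi u != phi v.
    by move=> euv; have := forallP (phiP u) v; rewrite euv.
  split; last exact: phi_ne.
  apply/forallP => u; apply/forallP => v; apply/implyP => /andP[euv _].
  exact: phi_ne.
pose g (psi : {ffun {v : T | v != y} -> 'I_n}) : {ffun T -> 'I_n} :=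
  [ffun u => psi (m u)].
have g_inj : injective g.
  move=> psi psi' /ffunP eq_g; apply/ffunP => -[u uy]; have := eq_g u.
  by rewrite !ffunE (_ : m u = exist _ u uy) //; apply: val_inj; rewrite mE.
rewrite -[RHS](card_imset _ g_inj); apply: eq_card => phi; apply/idP/imsetP.
  rewrite !inE negbK => /andP[/eqP eq_phi /forallP phiP].
  have gK : phi = g [ffun u => phi (val u)].
    apply/ffunP => u; rewrite !ffunE.
    by have [->|uy] := eqVneq u y; [rewrite my mE|rewrite mE].
  exists [ffun u => phi (val u)] => //; rewrite inE.
  apply/forallP => u; apply/forallP => v; apply/implyP.
  case/existsP => u' /existsP[v' /and3P[/eqP <- /eqP <- e_uv]].
  have := forallP (phiP u') v'; rewrite e_uv {1 2}gK /= ![g _ _]ffunE.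
  by [].
case=> psi; rewrite inE => /forallP psiP ->; rewrite !inE !ffunE my eqxx /=.
apply/forallP => u; apply/forallP => v; apply/implyP => e_uv.
rewrite !ffunE; have := forallP (psiP (m u)) (m v) => /implyP; apply.
by apply/existsP; exists u; apply/existsP; exists v; rewrite !eqxx.
Qed.

(** * Eulerian numbers and the inequality *)

Local Open Scope nat_scope.

(** Eulerian numbers, shifted: for d > 0, permutations of d letters with s - 1 descents. *)
Fixpoint eulerian (d s : nat) : nat :=
  match d, s with
  | 0, _ => s == 0
  | d'.+1, 0 => 0
  | d'.+1, s'.+1 => s * eulerian d' s + (d - s') * eulerian d' s'
  end.

Arguments eulerian : simpl never.

Lemma eulerianS0 (d : nat) : eulerian d.+1 0 = 0. Proof. by []. Qed.

Lemma eulerianSS (d s : nat) :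
  eulerian d.+1 s.+1 = s.+1 * eulerian d s.+1 + (d.+1 - s) * eulerian d s.
Proof. by []. Qed.

Lemma eulerian_small (d s : nat) : d < s -> eulerian d s = 0.
Proof.
elim: d s => [|d IHd] [|s] // lt_ds.
by rewrite eulerianSS !IHd ?muln0 //; lia.
Qed.

(** The reflection exchanges the two terms of the recurrence. *)
Lemma eulerian_sym (d s : nat) : s <= d.+2 ->
  eulerian d.+1 s = eulerian d.+1 (d.+2 - s).
Proof.
elim: d s => [|d IHd] s; first by case: s => [|[|[|s]]].
case: s => [|s] le_sd; first by rewrite eulerianS0 eulerian_small.
have [->|ne_s] := eqVneq s d.+2; first by rewrite subnn eulerian_small.
have -> : d.+3 - s.+1 = (d.+1 - s).+1 by lia.
rewrite !(eulerianSS d.+1) (IHd s); last lia.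
rewrite (IHd s.+1); last lia.
have -> : d.+2 - s = (d.+1 - s).+1 by lia.
have -> : d.+2 - s.+1 = d.+1 - s by lia.
have -> : d.+2 - (d.+1 - s) = s.+1 by lia.
by rewrite addnC.
Qed.

Lemma eulerian1 (d : nat) : eulerian d.+1 1 = 1.
Proof. by elim: d => // d IHd; rewrite eulerianSS IHd eulerianS0 muln0. Qed.

(** Multiplication by n in the binomial bases; its two coefficients are those of the Eulerian
    recurrence. *)
Lemma mul_bin_split (n d s : nat) : s <= d ->
  n * 'C(n + d - s, d) =
  s * 'C(n + d.+1 - s, d.+1) + (d.+1 - s) * 'C(n + d - s, d.+1).
Proof.
move=> le_sd; have -> : n + d.+1 - s = (n + d - s).+1 by lia.
rewrite binS mulnDr addnAC -mulnDl subnKC; last by lia.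
rewrite mul_bin_left -mulnDl.
have [lt_nd|] := ltnP (n + d - s) d; first by rewrite bin_small ?muln0.
by move=> ?; congr (_ * _); lia.
Qed.

(** Worpitzky's identity identifies the numerator of the edgeless graph, which has n^d colorings. *)
Lemma worpitzky (n d : nat) :
  n ^ d = \sum_(s < d.+1) eulerian d s * 'C(n + d - s, d).
Proof.
elim: d => [|d IHd]; first by rewrite big_ord1 bin0.
rewrite expnS IHd big_distrr /=.
under eq_bigr => s _.
  rewrite mulnCA mul_bin_split -1?ltnS // mulnDr mulnCA mulnA.
  rewrite [X in _ + X]mulnA (mulnC _ (d.+1 - s)). over.
rewrite big_split [RHS]big_ord_recl /= eulerianS0 mul0n add0n.
under [RHS]eq_bigr => s _.
  rewrite /bump leq0n add1n eulerianSS mulnDl. over.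
rewrite [RHS]big_split /=; congr (_ + _).
  rewrite [RHS]big_ord_recr /= eulerian_small // muln0 mul0n addn0.
  rewrite [LHS]big_ord_recl /= !mul0n add0n.
  by apply: eq_bigr => s _; rewrite /bump leq0n add1n.
by apply: eq_bigr => s _; rewrite addnS subSS.
Qed.

Local Open Scope ring_scope.

Lemma sumr_backward_diff (V : zmodType) (u : nat -> V) (i : nat) :
  \sum_(j < i) (u j - (if j : nat is m.+1 then u m else 0)) =
  if i is m.+1 then u m else 0.
Proof.
elim: i => [|i IHi]; first by rewrite big_ord0.
by rewrite big_ord_recr /= IHi addrCA subrr addr0.
Qed.

(** The first clause makes the degree exactly [#|T|]; both clauses are carried through the induction
    on edges. *)
Definition top_heavy (T : finType) (e : rel T) : Prop :=
  1 <= chromatic_hvec e #|T| /\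
  forall i : nat, (i <= #|T|)%N ->
    \sum_(j < i) chromatic_hvec e j <=
    \sum_(j < i) chromatic_hvec e (#|T| - j).

Lemma top_heavy_edgeless (T : finType) (e : rel T) :
  (forall x y, ~~ e x y) -> top_heavy e.
Proof.
move=> e0; have hE i : (i <= #|T|)%N -> chromatic_hvec e i = (eulerian #|T| i)%:Z.
  move=> le_i; rewrite /chromatic_hvec (@hvec_expansion _ _ (eulerian #|T|)) ?le_i //.
  move=> n; rewrite -worpitzky -[n in RHS]card_ord -card_ffun.
  apply: eq_card => phi; rewrite inE; apply/forallP => x; apply/forallP => y.
  by rewrite (negPf (e0 x y)).
rewrite /top_heavy hE //; split=> [|i le_i].
  by case: #|T| => // d; rewrite eulerian_sym // subSnn eulerian1.
under eq_bigr => j _ do rewrite hE ?(leq_trans (ltnW (ltn_ord j))) //.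
under [leRHS]eq_bigr => j _ do rewrite hE ?leq_subr //.
case: #|T| le_i => [|d]; first by rewrite leqn0 => /eqP ->; rewrite !big_ord0.
move=> le_i.
have eq_shift : \sum_(j < i) (eulerian d.+1 (d.+1 - j))%:Z =
    \sum_(j < i) (eulerian d.+1 j.+1)%:Z.
  apply: eq_bigr => j _; have lt_j := ltn_ord j.
  rewrite eulerian_sym; last by lia.
  by congr (Posz (eulerian _ _)); lia.
(* Splitting this sum at its last term and at its first, which is 0, shows that the two sides differ
   by h_i. *)
have : \sum_(j < i.+1) (eulerian d.+1 j)%:Z = \sum_(j < i.+1) (eulerian d.+1 j)%:Z.
  by [].
rewrite {1}big_ord_recr big_ord_recl /= eulerianS0 add0r.
under [in RHS]eq_bigr do rewrite /bump leq0n add1n.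
by rewrite eq_shift => <-; rewrite lerDl.
Qed.

Lemma chromatic_hvec_delete (T : finType) (e : rel T) (x y : T)
    (neq_xy : x != y) (i : nat) : e x y ->
  let h' := chromatic_hvec (contract_edge (delete_edge e x y) neq_xy) in
  chromatic_hvec e i =
  chromatic_hvec (delete_edge e x y) i - (h' i - (if i is j.+1 then h' j else 0)).
Proof.
move=> exy h'; rewrite /h' /chromatic_hvec -(card_contracted y) -hvecS -hvecB.
apply: eq_hvec => n; rewrite (deletion_contraction neq_xy n exy).
by rewrite PoszD addrK.
Qed.

Lemma top_heavy_delete (T : finType) (e : rel T) (x y : T) :
  x != y -> e x y -> top_heavy (delete_edge e x y) -> top_heavy e.
Proof.
move=> neq_xy exy [h0_ge1 h0_sum].
have hE i := chromatic_hvec_delete neq_xy i exy.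
set h' := chromatic_hvec _ in hE; set h0 := chromatic_hvec _ in h0_ge1 h0_sum hE.
have cardS := card_contracted y.
have h'_top : h' #|T| = 0 by apply: chromatic_hvec_eq0; rewrite cardS.
have h'_ge0 i : 0 <= h' i by apply: chromatic_hvec_ge0.
split=> [|i le_i].
  (* The top coefficient grows by h'_(d-1). *)
  rewrite hE h'_top sub0r opprK; case: {2}#|T| => [|k]; first by rewrite addr0.
  by rewrite ler_wpDr.
under eq_bigr => j _ do rewrite hE.
rewrite sumrB sumr_backward_diff.
(* The differences of [h'] telescope downwards from h'_d = 0, leaving h'_(d-i). *)
have -> : \sum_(j < i) chromatic_hvec e (#|T| - j) =
    \sum_(j < i) h0 (#|T| - j)%N + h' (#|T| - i)%N.
  have <- : h' (#|T| - i)%N - h' #|T| = h' (#|T| - i)%N by rewrite h'_top subr0.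
  elim: i le_i => [|i IHi] lt_i; first by rewrite !big_ord0 subn0 subrr addr0.
  rewrite !big_ord_recr /= IHi ?(ltnW lt_i) // hE.
  have -> : (#|T| - i = (#|T| - i.+1).+1)%N by lia.
  ring.
apply: lerD; first exact: h0_sum.
apply: le_trans (h'_ge0 _); rewrite oppr_le0.
by case: (i).
Qed.

Lemma chromatic_top_heavy (T : finType) (e : rel T) :
  irreflexive e -> top_heavy e.
Proof.
(* Induction on the number of ordered pairs in [e]. *)
have [N] := ubnP #|[set p | e p.1 p.2]|.
elim: N e => // N IHN e; rewrite ltnS => le_N e_irr.
have [/forallP e0|] := boolP [forall x, forall y, ~~ e x y].
  by apply: top_heavy_edgeless => x; apply/forallP/e0.
rewrite negb_forall => /existsP[x]; rewrite negb_forall => /existsP[y].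
rewrite negbK => exy.
have neq_xy : x != y by apply: contraTneq exy => ->; rewrite e_irr.
apply: (top_heavy_delete neq_xy exy); apply: IHN => [|z]; last first.
  by rewrite /delete_edge /= e_irr.
apply: leq_trans le_N; apply: proper_card; apply/properP; split.
  by apply/subsetP => p; rewrite !inE => /andP[].
by exists (x, y); rewrite !inE /delete_edge ?exy //= !inE eqxx andbF.
Qed.

Theorem theorem1p4 (T : finType) (e : rel T) (d : nat)
    (e_sym : symmetric e) (e_irr : irreflexive e) (cardT : #|T| = d)
    (hG : nat -> int) (hGP : chromatic_numerator e hG) :
  exists h : {poly int},
    [/\ pseries_of_poly h =1 hG,
        size h = d.+1,
        forall i : nat, 0 <= h`_i
      & forall i : nat, (1 <= i <= d.+1./2)%N ->
          0 <= \sum_(j < i) h`_(d - j) - \sum_(j < i) h`_j].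
Proof.
have hGE i : hG i = chromatic_hvec e i by rewrite -hGP.
have [h_top h_sum] := chromatic_top_heavy e_irr; rewrite cardT in h_top h_sum.
exists (\poly_(i < d.+1) chromatic_hvec e i).
have coefh i : (\poly_(i < d.+1) chromatic_hvec e i)`_i = chromatic_hvec e i.
  by rewrite coef_poly ltnS; case: leqP => // lt_di; rewrite chromatic_hvec_eq0 ?cardT.
split.
- by move=> i; rewrite hGE -coefh.
- by rewrite size_poly_eq // gt_eqF // (lt_le_trans _ h_top).
- by move=> i; rewrite coefh chromatic_hvec_ge0.
move=> i /andP[i_gt0 le_i]; rewrite subr_ge0.
under eq_bigr do rewrite coefh.
under [leRHS]eq_bigr do rewrite coefh.
by apply: h_sum; lia.
Qed.
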